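(* Given an MQ system $S\subset\mathbb{F}[x_1,\dots,x_{\mathsf n}]$ consisting of $\mathsf m$ equations, the reduction $\beta$ from MQ to MLD (described in the context) runs in polynomial space bounded by $\mathcal{O}(\mathsf n^4\mathsf m^2)$.
   Context: $\mathbb{F}=\mathbb{F}_2$. An MQ system is a set of equations $f_h=0$, $h=1,\dots,\mathsf m$, with $f_h=\sum_{i<j}\gamma^{(h)}_{ij}x_ix_j+\sum_i\lambda^{(h)}_ix_i+\delta^{(h)}$ over $\mathbb{F}$. An MLD instance is a triple $(H,s,t)$ with $H\in\mathbb{F}^{m\times n}$, $s\in\mathbb{F}^m$, $t\le n$ a positive integer (asking for $v\in\mathbb{F}^n$ of Hamming weight at most $t$ with $Hv^\top=s^\top$). The space used by $\beta$ is measured by the size (number of entries) of the parity-check matrix $H$ it generates, $s$ and $t$ being of significantly smaller size. A system is in standard form if it consists only of: equations of the form $xy+z=0$ which do not share any variable; and linear equations of the form $x+\delta=0$, $x+y+\delta=0$ or $x+y+z+\delta=0$ with $\delta\in\mathbb{F}$; and each variable appearing in a linear equation also appears in exactly one quadratic equation. Hence a standard-form system with $q$ quadratic equations is regarded as a system in exactly $3q$ variables. The reduction $\beta$ first takes $S$ to a standard-form system $S'$, as follows. The variable $x_k$ in the $h$-th polynomial is renamed to a new variable $X_{h,k}$, and the linear equations $X_{h,k}+x_k=0$ ($h=1,\dots,\mathsf m$, $k=1,\dots,\mathsf n$) are added. Then each polynomial is treated separately: (1) for each of its quadratic monomials $x_ix_j$ (in the renamed variables) a new variable $x_{ij}$ and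 the equation $x_{ij}+x_ix_j=0$ are introduced, and $x_{ij}$ is substituted for the monomial, giving a linear polynomial $f'$; (2) whenever a variable is shared by several of these quadratic equations, the repeated occurrences are replaced by new variables, e.g. $x_{1,i}+x_1x_i=0$ and $x_{2,i}+x_2x_i=0$ become $x_{1,i}+x_1x_i=0$, $x_{2,i}+x_2x_i'=0$, $x_i+x_i'=0$; (3) $f'$ is replaced by linear equations involving three variables each, by introducing partial sums as new variables, in the way that $x_1+x_2+\dots+x_l=0$ is equivalent to the $l-2$ equations $x_1+x_2+y_2=0$, $y_2+x_3+y_3=0$, ..., $y_{l-3}+x_{l-2}+y_{l-2}=0$, $y_{l-2}+x_{l-1}+x_l=0$. Next, let $S'$ have $q$ quadratic equations and linear equations given by polynomials $f_1,\dots,f_\lambda$ in $\mathbb{F}[x_1,\dots,x_{3q}]$, the $i$-th quadratic equation being in the $i$-th triple of variables, $x_{3i-2}x_{3i-1}+x_{3i}=0$. Let $\widehat C\subset\mathbb{F}^{10}$ be the code generated by the rows of $$\widehat G=\begin{bmatrix}1&0&0&1&1&0&0&1&1&1\\0&1&0&0&0&1&1&1&1&1\\0&0&1&1&1&1&1&1&1&1\end{bmatrix},$$ let $\widehat H\in\mathbb{F}^{7\times10}$ be a parity-check matrix of $\widehat C$, $\widehat\epsilon=(0,0,0,0,0,0,0,1,1,1)$, $\widetilde H$ the $7q\times10q$ block-diagonal matrix with $q$ blocks $\widehat H$, $\widetilde\epsilon$ the concatenation of $q$ copies of $\widehat\epsilon$, and $\widetilde s$ the syndrome $\widetilde H\widetilde\epsilon^\top$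 (written as a row vector). For a linear polynomial $f=\sum_{i=1}^{3q}a_ix_i+\delta$ let $\nu(f)\in\mathbb{F}^{10q}$ be the concatenation of the $q$ blocks $(a_{3i-2},a_{3i-1},a_{3i},0,0,0,0,0,0,0)$, $i=1,\dots,q$. The output of $\beta$ is $(H,s,t)$, where $H\in\mathbb{F}^{(7q+\lambda)\times10q}$ has the rows of $\widetilde H$ followed by the rows $\nu(f_1),\dots,\nu(f_\lambda)$, $s=\widetilde s\,\|\,f_1(0)\,\|\cdots\|\,f_\lambda(0)$ (concatenation), and $t=3q$.
   Formalization: Steps (1)–(3) alone do not give a standard-form system; here β also adds, for each variable v of a linear equation in no quadratic equation, va+b=0 with a,b new, and replaces a constant f'=δ by y=0, y+δ=0 with y new. *)

(* Defs.v *)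
From HB Require Import structures.
From mathcomp Require Import all_boot all_order all_algebra.
From mathcomp.multinomials Require Export mpoly.

Set Implicit Arguments.
Unset Strict Implicit.
Unset Printing Implicit Defensive.

Import GRing.Theory.
Local Open Scope ring_scope.

Definition mq_poly (n : nat) (f : {mpoly 'F_2[n]}) : Prop :=
  exists (gamma : 'I_n -> 'I_n -> 'F_2) (lambda : 'I_n -> 'F_2) (delta : 'F_2),
    f = \sum_(i < n) \sum_(j < n | (i < j)%N) gamma i j *: ('X_i * 'X_j)
        + \sum_(i < n) lambda i *: 'X_i + delta%:MP.

Definition mq_system (m n : nat) (S : 'I_m -> {mpoly 'F_2[n]}) : Prop :=
  forall h, mq_poly (S h).

(* Names of the variables of the standard-form system. *)
Inductive var : Type :=
  | Orig of nat                (* x_k *)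
  | Ren of nat & nat           (* X_{h,k} *)
  | Mon of nat & nat & nat     (* x_ij in the h-th polynomial *)
  | Copy of bool & var         (* new name for the left (false) or right (true)
                                  factor of the quadratic equation defining
                                  the given variable *)
  | Psum of nat & nat          (* y_k in the h-th polynomial *)
  | Pad of bool & var.         (* the two new variables of a quadratic equation
                                  added for the given variable *)

Definition var_eq_dec : comparable var.
Proof. by rewrite /comparable /decidable; do !decide equality. Defined.

HB.instance Definition _ := hasDecEq.Build var (compareP var_eq_dec).

(* (x, y, z) stands for x y + z = 0. *)
Definition quad_eq : Type := var * var * var.
(* (vs, delta) stands for (sum of vs) + delta = 0. *)
Definition lin_eq : Type := seq var * 'F_2.

Record system := System { quads : seq quad_eq; lins : seq lin_eq }.

Definition quad_vars (qs : seq quad_eq) : seq var :=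
  flatten [seq [:: e.1.1; e.1.2; e.2] | e <- qs].

Definition monomials (n : nat) (f : {mpoly 'F_2[n]}) : seq ('I_n * 'I_n) :=
  [seq p : 'I_n * 'I_n <- enum {: 'I_n * 'I_n} |
    (p.1 < p.2)%N && (f@_(U_(p.1) + U_(p.2)) != 0)].

(* The first occurrence of a variable as a factor keeps its name; [seen] are the
   factors already met. *)
Fixpoint unshare (seen : seq var) (qs : seq quad_eq) :
    seq quad_eq * seq lin_eq :=
  if qs is (x, y, z) :: qs' then
    let x' := if x \in seen then Copy false z else x in
    let y' := if y \in x :: seen then Copy true z else y in
    let r := unshare [:: x, y & seen] qs' in
    ((x', y', z) :: r.1,
     [seq ([:: p.1; p.2], 0) | p <- [:: (x, x'); (y, y')] & p.1 != p.2] ++ r.2)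
  else ([::], [::]).

(* The constant term is put in the last equation. *)
Fixpoint chain (h k : nat) (a b : var) (vs : seq var) (delta : 'F_2) :
    seq lin_eq :=
  match vs with
  | [::] => [:: ([:: a; b], delta)]
  | [:: c] => [:: ([:: a; b; c], delta)]
  | c :: vs' =>
      ([:: a; b; Psum h k], 0) :: chain h k.+1 (Psum h k) c vs' delta
  end.

(* A polynomial without variables is not an admissible linear equation: the
   empty sum gets a name too. *)
Definition split_lin (h : nat) (vs : seq var) (delta : 'F_2) : seq lin_eq :=
  match vs with
  | [::] => [:: ([:: Psum h 0], 0); ([:: Psum h 0], delta)]
  | [:: a] => [:: ([:: a], delta)]
  | a :: b :: vs' => chain h 2 a b vs' delta
  end.

Definition std_poly (n h : nat) (f : {mpoly 'F_2[n]}) : system :=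
  let ms := monomials f in
  let r := unshare [::] [seq (Ren h p.1, Ren h p.2, Mon h p.1 p.2) | p : 'I_n * 'I_n <- ms] in
  let terms := [seq Mon h p.1 p.2 | p : 'I_n * 'I_n <- ms]
                 ++ [seq Ren h k | k : 'I_n <- enum 'I_n & f@_U_(k) != 0] in
  System r.1 (r.2 ++ split_lin h terms f@_0).

(* In a standard-form system every variable v of a linear equation appears in
   exactly one quadratic equation.  If v appears in none, v a + b = 0 is added,
   with a and b new, which does not constrain v. *)
Definition pad (S : system) : system :=
  let loose := undup [seq v <- flatten (map fst (lins S)) |
                       v \notin quad_vars (quads S)] in
  System (quads S ++ [seq (v, Pad false v, Pad true v) | v <- loose]) (lins S).

Definition std_system (m n : nat) (S : 'I_m -> {mpoly 'F_2[n]}) : system :=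
  let parts := [seq std_poly h (S h) | h : 'I_m <- enum 'I_m] in
  pad (System
    (flatten (map quads parts))
    ([seq ([:: Ren p.1 p.2; Orig p.2], 0) | p : 'I_m * 'I_n <- enum {: 'I_m * 'I_n}]
       ++ flatten (map lins parts))).

Record mld := MLD {
  mld_rows : nat;
  mld_cols : nat;
  mld_H : 'M['F_2]_(mld_rows, mld_cols);
  mld_s : 'rV['F_2]_mld_rows;
  mld_t : nat
}.

Definition mld_size (I : mld) : nat := (mld_rows I * mld_cols I)%N.

Definition parity_check (k r n : nat)
    (G : 'M['F_2]_(k, n)) (H : 'M['F_2]_(r, n)) : Prop :=
  \rank H = r /\ forall v : 'rV['F_2]_n, (v <= G)%MS <-> H *m v^T = 0.

Definition Ghat : 'M['F_2]_(3, 10) :=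
  \matrix_(i < 3, j < 10)
    (nth 0 (nth [::] [:: [:: 1; 0; 0; 1; 1; 0; 0; 1; 1; 1];
                         [:: 0; 1; 0; 0; 0; 1; 1; 1; 1; 1];
                         [:: 0; 0; 1; 1; 1; 1; 1; 1; 1; 1]] i) j)%N%:R.

Definition epshat : 'rV['F_2]_10 :=
  \row_(j < 10) (nth 0 [:: 0; 0; 0; 0; 0; 0; 0; 1; 1; 1] j)%N%:R.

Lemma triple_subproof (q : nat) (i : 'I_q) (k : 'I_3) : (3 * i + k < 3 * q)%N.
Proof.
have le_iq : (3 * i.+1 <= 3 * q)%N by rewrite leq_mul2l ltn_ord.
by apply: leq_trans le_iq; rewrite mulnS addnC ltn_add2r.
Qed.

Definition triple (q : nat) (i : 'I_q) (k : 'I_3) : 'I_(3 * q) :=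
  Ordinal (triple_subproof i k).

(* The i-th quadratic equation is in the i-th triple of variables: each name is
   replaced by the variable at its position in [quad_vars]. *)
Definition lin_mpoly (qs : seq quad_eq) (e : lin_eq) :
    {mpoly 'F_2[3 * size qs]} :=
  \sum_(v <- e.1)
     \sum_(i < 3 * size qs | onth (quad_vars qs) i == Some v) 'X_i
  + e.2%:MP.

(* [\sum_(i < q) 10] is 10 q: this is the width that [\mxrow] and [\mxblock]
   give to q consecutive blocks of width 10. *)
Definition nu (q : nat) (f : {mpoly 'F_2[3 * q]}) : 'rV['F_2]_(\sum_(i < q) 10) :=
  \mxrow_(i < q)
    (row_mx (\row_(k < 3) f@_U_(triple i k)) (0 : 'rV_7) : 'rV['F_2]_10).

Definition mld_of_std (Hhat : 'M['F_2]_(7, 10)) (q : nat)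
    (fs : seq {mpoly 'F_2[3 * q]}) : mld :=
  let Htilde := \mxblock_(i < q, j < q) (if i == j then Hhat else 0) in
  let epstilde := \mxrow_(i < q) epshat in
  let f (i : 'I_(size fs)) := tnth (in_tuple fs) i in
  @MLD (\sum_(i < q) 7 + size fs) (\sum_(i < q) 10)
    (col_mx Htilde (\matrix_(i < size fs) nu (f i)))
    (row_mx (Htilde *m epstilde^T)^T (\row_(i < size fs) (f i).@[fun=> 0]))
    (3 * q).

Definition beta (Hhat : 'M['F_2]_(7, 10)) (m n : nat)
    (S : 'I_m -> {mpoly 'F_2[n]}) : mld :=
  let S' := std_system S in
  mld_of_std Hhat (map (lin_mpoly (quads S')) (lins S')).

(* Main.v *)
(** With [n] variables and [m] equations, each polynomial has at most [n ^ 2]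
    quadratic monomials, and linearizing, unsharing and splitting it yields
    [O(n ^ 2)] equations, each linear one in at most three variables.  Hence the
    padding at most triples the number [lambda = O(m n ^ 2)] of linear equations,
    so the number [q] of quadratic equations is [O(m n ^ 2)] too, and the
    parity-check matrix has [(7 q + lambda) * 10 q = O(m ^ 2 n ^ 4)] entries. *)
Require Import Defs.
From mathcomp Require Import all_boot all_order all_algebra.
From mathcomp Require Import zify.

(** Caps at three the number of variables that one linear equation can hand over to [pad]. *)
Definition short_lin (e : lin_eq) : bool := size e.1 <= 3.

Lemma size_lins_vars (l : seq lin_eq) :
  all short_lin l -> size (flatten (map fst l)) <= 3 * size l.
Proof.
elim: l => [|e l IHl] //= /andP[short_e /IHl le_l].
by rewrite size_cat mulnS leq_add.
Qed.

Lemma size_flatten_le (T U : Type) (f : T -> seq U) (s : seq T) (c : nat) :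
  (forall x, size (f x) <= c) -> size (flatten (map f s)) <= c * size s.
Proof.
move=> le_c; elim: s => [|x s IHs] //=.
by rewrite size_cat mulnS leq_add.
Qed.

Lemma all_flatten_map (T U : Type) (a : pred U) (f : T -> seq U) (s : seq T) :
  (forall x, all a (f x)) -> all a (flatten (map f s)).
Proof. by move=> a_f; elim: s => //= x s IHs; rewrite all_cat a_f. Qed.

Lemma size_monomials (n : nat) (f : {mpoly 'F_2[n]}) :
  size (monomials f) <= n ^ 2.
Proof.
rewrite size_filter (leq_trans (count_size _ _)) //.
by rewrite -cardE card_prod card_ord mulnn.
Qed.

Lemma size_unshare_quads (seen : seq var) (qs : seq quad_eq) :
  size (unshare seen qs).1 = size qs.
Proof. by elim: qs seen => [|[[x y] z] qs IHqs] seen //=; rewrite IHqs. Qed.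

(** Each quadratic equation has two factors, and each factor gives at most one linking equation. *)
Lemma size_unshare_lins (seen : seq var) (qs : seq quad_eq) :
  size (unshare seen qs).2 <= 2 * size qs.
Proof.
elim: qs seen => [|[[x y] z] qs IHqs] seen //.
rewrite size_cat mulnS leq_add // size_map size_filter.
exact: (count_size _ [:: _; _]).
Qed.

Lemma short_unshare (seen : seq var) (qs : seq quad_eq) :
  all short_lin (unshare seen qs).2.
Proof.
elim: qs seen => [|[[x y] z] qs IHqs] seen //.
by rewrite all_cat IHqs andbT all_map; apply/allP.
Qed.

(** Every equation but the last absorbs one element of [vs]; equality holds only for empty [vs]. *)
Lemma size_chain (h k : nat) (a b : var) (vs : seq var) (delta : 'F_2) :
  size (chain h k a b vs delta) <= (size vs).+1.
Proof.
elim: vs h k a b => [|c [|d vs] IHvs] h k a b //.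
exact: (IHvs h k.+1 (Psum h k) c).
Qed.

Lemma short_chain (h k : nat) (a b : var) (vs : seq var) (delta : 'F_2) :
  all short_lin (chain h k a b vs delta).
Proof.
elim: vs h k a b => [|c [|d vs] IHvs] h k a b //.
exact: (IHvs h k.+1 (Psum h k) c).
Qed.

(** The summand 2 is forced by the empty sum, which yields two equations. *)
Lemma size_split_lin (h : nat) (vs : seq var) (delta : 'F_2) :
  size (split_lin h vs delta) <= size vs + 2.
Proof.
case: vs => [|a [|b vs]] //=.
by rewrite (leq_trans (size_chain _ _ _ _ _ _)) //; lia.
Qed.

Lemma short_split_lin (h : nat) (vs : seq var) (delta : 'F_2) :
  all short_lin (split_lin h vs delta).
Proof. by case: vs => [|a [|b vs]] //=; apply: short_chain. Qed.

Lemma size_std_poly_quads (n h : nat) (f : {mpoly 'F_2[n]}) :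
  size (quads (std_poly h f)) <= n ^ 2.
Proof. by rewrite /= size_unshare_quads size_map size_monomials. Qed.

(** Unsharing contributes [2 * n ^ 2]; splitting a sum of at most [n ^ 2 + n] terms contributes the
    rest. *)
Lemma size_std_poly_lins (n h : nat) (f : {mpoly 'F_2[n]}) :
  size (lins (std_poly h f)) <= 3 * n ^ 2 + n + 2.
Proof.
have le_ms := size_monomials _ f.
rewrite /= size_cat.
set r := unshare _ _; set terms := _ ++ _.
have le_r : size r.2 <= 2 * n ^ 2.
  by rewrite (leq_trans (size_unshare_lins _ _)) // size_map leq_mul2l le_ms.
have le_terms : size terms <= n ^ 2 + n.
  rewrite size_cat !size_map leq_add // size_filter.
  by rewrite (leq_trans (count_size _ _)) // size_enum_ord.
have := size_split_lin h terms (f@_0)%R.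
lia.
Qed.

Lemma short_std_poly (n h : nat) (f : {mpoly 'F_2[n]}) :
  all short_lin (lins (std_poly h f)).
Proof. by rewrite /= all_cat short_unshare short_split_lin. Qed.

(** The loose variables are at most as many as the variable occurrences in the linear equations. *)
Lemma size_pad_quads (S : system) :
  all short_lin (lins S) ->
  size (quads (pad S)) <= size (quads S) + 3 * size (lins S).
Proof.
move=> /size_lins_vars le_vars.
rewrite /= size_cat size_map leq_add2l (leq_trans (size_undup _)) //.
by rewrite size_filter (leq_trans (count_size _ _)).
Qed.

Lemma size_std_system_lins (m n : nat) (S : 'I_m -> {mpoly 'F_2[n]}) :
  size (lins (std_system S)) <= m * (3 * n ^ 2 + 2 * n + 2).
Proof.
(* The [m * n] renaming equations account for the second [n] per polynomial. *)
rewrite size_cat size_map -cardE card_prod !card_ord -map_comp.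
set parts := flatten _.
have : size parts <= (3 * n ^ 2 + n + 2) * size (enum 'I_m).
  by apply: size_flatten_le => h; apply: size_std_poly_lins.
rewrite size_enum_ord; nia.
Qed.

Lemma size_std_system_quads (m n : nat) (S : 'I_m -> {mpoly 'F_2[n]}) :
  size (quads (std_system S)) <= m * n ^ 2 + 3 * size (lins (std_system S)).
Proof.
apply: (leq_trans (size_pad_quads _ _)).
  rewrite all_cat -map_comp all_flatten_map ?andbT => [|h]; last exact: short_std_poly.
  by rewrite all_map; apply/allP.
rewrite leq_add2r -map_comp mulnC -[m in _ * m]size_enum_ord.
by apply: size_flatten_le => h; apply: size_std_poly_quads.
Qed.

Lemma mld_size_beta (Hhat : 'M['F_2]_(7, 10)) (m n : nat)
    (S : 'I_m -> {mpoly 'F_2[n]}) :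
  let q := size (quads (std_system S)) in
  mld_size (beta Hhat S) = (7 * q + size (lins (std_system S))) * (10 * q).
Proof.
by rewrite /mld_size /beta /= size_map !sum_nat_const card_ord ![_ * size _]mulnC.
Qed.

Theorem theorem4p17 (Hhat : 'M['F_2]_(7, 10)) :
  parity_check Ghat Hhat ->
  exists C : nat,
    forall (m n : nat) (S : 'I_m -> {mpoly 'F_2[n]}),
      (0 < m)%N -> (0 < n)%N -> mq_system S ->
      (mld_size (beta Hhat S) <= C * (n ^ 4 * m ^ 2))%N.
Proof.
(* With [N = m * n ^ 2], there are at most [7 * N] linear equations, as 7 = 3 + 2 + 2 and [n] and 1
   are at most [n ^ 2]; hence at most [22 * N] quadratic ones, as 22 = 1 + 3 * 7. *)
move=> _; exists ((7 * 22 + 7) * (10 * 22)) => m n S _ n_gt0 _.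
rewrite mld_size_beta.
set N := m * n ^ 2.
have le_lins : size (lins (std_system S)) <= 7 * N.
  apply: leq_trans (size_std_system_lins _ _ S) _.
  by rewrite /N mulnCA leq_mul2l; apply/orP; right; nia.
have le_quads : size (quads (std_system S)) <= 22 * N.
  by have := size_std_system_quads _ _ S; rewrite -/N; lia.
have -> : n ^ 4 * m ^ 2 = N * N by rewrite /N; lia.
(* One factor [N] goes to the row count and one to the column count. *)
rewrite mulnACA leq_mul // -?mulnA ?leq_mul2l //.
by rewrite mulnDl -mulnA leq_add // leq_mul2l.
Qed.
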